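(* Let $\Delta=(n_1^{p_1},\dots,n_k^{p_k})$ be a partition of $n$ with $n_1<\dots<n_k\le p$, $z\in M(d,n;\mathbb{F}_q)$, and $w=\mathrm{diag}(w_1,\dots,w_k)\in W_\Delta$ with $w_i=\mathrm{diag}(\mu(c_{i,1}),\dots,\mu(c_{i,p_i}))\widetilde P_{\sigma_i}$. Then the map $$f_w\colon X_{\Delta,z}\to X_{\Delta,zw},\quad((t_{(i,j)},u_{(i,j)}),s)\mapsto((t'_{(i,j)},u'_{(i,j)}),s),$$ $$t'_{(i,j)}=t_{(i,\sigma_i(j))},\qquad u'_{(i,j)}=u_{(i,\sigma_i(j))}\,\mu(c_{i,\sigma_i(j)})',$$ is an isomorphism over $\mathbb{F}_q$.
   Context: $q$ is a power of a prime $p$, $N=q-1$. For $m\ge1$ let $\Lambda$ be the $m\times m$ matrix with $1$'s on the superdiagonal, $[h_0,\dots,h_{m-1}]=\sum_ih_i\Lambda^i$. For $x=(x_0,x_1,\dots)$, $X_j=x_j/x_0$, $\theta_i(x)=\sum_{k_1+2k_2+\dots+ik_i=i,\,k_j\ge0}(-1)^{k_1+\dots+k_i-1}\frac{(k_1+\dots+k_i-1)!}{k_1!\cdots k_i!}X_1^{k_1}\cdots X_i^{k_i}$ and $\overline\theta_i(x)=x_0^i\theta_i(x)$. $\Delta=(n_1^{p_1},\dots)$ means $n_i$ repeated $p_i$ times. Write $z=(z^{(1)},\dots,z^{(k)})$, $z^{(i)}=(z^{(i,1)},\dots,z^{(i,p_i)})$ with $z^{(i,j)}\in M(d,n_i;\mathbb{F}_q)$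 consecutive column blocks, $z^{(i,j)}=(z^{(i,j)}_0,\dots,z^{(i,j)}_{n_i-1})$. $X_{\Delta,z}$ is the affine variety over $\mathbb{F}_q$ in coordinates $t_{(i,j)}$, $u_{(i,j)}=(u_{(i,j,1)},\dots,u_{(i,j,n_i-1)})$ (row vectors), $s=(s_1,\dots,s_d)$, defined by $t_{(i,j)}^N=sz^{(i,j)}_0$, $t_{(i,j)}^{Nr}(u_{(i,j,r)}^q-u_{(i,j,r)})=\overline\theta_r(sz^{(i,j)})$ for $1\le r\le n_i-1$, $t_{(i,j)}\ne0$. Polynomials: $\mu_{a,b}(y)=0$ if $a>b$, $\mu_{0,0}=1$, otherwise $\mu_{a,b}(y)=\sum_{j_1,\dots,j_a\ge1,\,j_1+\dots+j_a=b}y_{j_1}\cdots y_{j_a}$. For $c=(c_1,\dots,c_{m-1})$, $\mu(c)=(\mu_{a,b}(c))_{0\le a,b\le m-1}$, $\mu(c)'=(\mu_{a,b}(c))_{1\le a,b\le m-1}$, $W(m)=\{\mu(c):c\in\mathbb{F}_q^{m-1},c_1\ne0\}$. For $\sigma\in S_{p_i}$, $\widetilde P_\sigma$ is the $n_ip_i\times n_ip_i$ block permutation matrix whose $j$-th block column has $I_{n_i}$ in block row $\sigma(j)$ and zero blocks elsewhere. $W_\Delta$ is the set of block-diagonal $w=\mathrm{diag}(w_1,\dots,w_k)$ with $w_i=\mathrm{diag}(\mu(c_{i,1}),\dots,\mu(c_{i,p_i}))\widetilde P_{\sigma_i}$, $\mu(c_{i,j})\in W(n_i)$, $\sigma_i\in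 S_{p_i}$. *)

(* Defs.v *)
From HB Require Import structures.
From mathcomp Require Import all_boot all_order all_fingroup all_algebra.
From mathcomp Require Import mpoly.

Set Implicit Arguments.
Unset Strict Implicit.
Unset Printing Implicit Defensive.

Import GRing.Theory.
Local Open Scope ring_scope.

(* Affine varieties over a field k, presented by coordinates, equations and
   inequations: Spec (k[x] / (eqn)) with every neq inverted. *)

Record affineVar (k : fieldType) := AffineVar {
  coord : finType;
  eqn_idx : finType;
  eqn : eqn_idx -> {mpoly k[#|coord|]};
  neq_idx : finType;
  neq : neq_idx -> {mpoly k[#|coord|]} }.

Definition var (k : fieldType) (I : finType) (i : I) : {mpoly k[#|I|]} :=
  'X_(enum_rank i).

Definition peval (k : fieldType) (I : finType) (A : comUnitAlgType k)
    (x : I -> A) (P : {mpoly k[#|I|]}) : A :=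
  mmap (GRing.in_alg A) (fun l => x (enum_val l)) P.

(* Points with values in a commutative k-algebra A; when A is a field, "unit"
   is "nonzero". *)
Definition is_point (k : fieldType) (V : affineVar k) (A : comUnitAlgType k)
    (x : coord V -> A) : Prop :=
  (forall e, peval x (eqn e) = 0) /\
  (forall j, peval x (neq j) \is a GRing.unit).

(* Representatives of regular functions on V defined over k: polynomials with
   coefficients in k in the coordinates (inl) and the inverses of the neq
   (inr). *)
Definition regfun (k : fieldType) (V : affineVar k) : Type :=
  {mpoly k[#|{: coord V + neq_idx V}|]}.

Definition reval (k : fieldType) (V : affineVar k) (A : comUnitAlgType k)
    (x : coord V -> A) (P : regfun V) : A :=
  peval (fun v : coord V + neq_idx V =>
           match v with inl i => x i | inr j => (peval x (neq j))^-1 end) P.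

Definition regmap (k : fieldType) (V W : affineVar k) : Type :=
  coord W -> regfun V.

Definition rmap (k : fieldType) (V W : affineVar k) (f : regmap V W)
    (A : comUnitAlgType k) (x : coord V -> A) : coord W -> A :=
  fun i => reval x (f i).

(* A runs over all commutative k-algebras, so morphisms and isomorphisms are
   those of k-schemes; in particular they are so on points over an algebraic
   closure of k. *)
Definition is_morphism (k : fieldType) (V W : affineVar k) (f : regmap V W) :
    Prop :=
  forall (A : comUnitAlgType k) (x : coord V -> A),
    is_point x -> is_point (rmap f x).

Definition is_isomorphism (k : fieldType) (V W : affineVar k)
    (f : regmap V W) : Prop :=
  is_morphism f /\
  exists g : regmap W V,
    [/\ is_morphism g,
        forall (A : comUnitAlgType k) (x : coord V -> A),
          is_point x -> rmap g (rmap f x) =1 x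
      & forall (A : comUnitAlgType k) (y : coord W -> A),
          is_point y -> rmap f (rmap g y) =1 y].

(* The entry of index r (counted from 0) of a row vector, 0 if out of range. *)
Definition entry (A : nmodType) (m : nat) (v : 'rV[A]_m) (r : nat) : A :=
  if insub r is Some o then v 0 o else 0.

(* In the exponent tuples k of theta, k l stands for k_(l+1); k_(l+1) <= i is
   forced by k_1 + 2 k_2 + ... + i k_i = i. *)
Definition theta_index (i : nat) (k : {ffun 'I_i -> 'I_i.+1}) : bool :=
  (\sum_(l < i) l.+1 * k l == i)%N.

Definition theta_size (i : nat) (k : {ffun 'I_i -> 'I_i.+1}) : nat :=
  (\sum_(l < i) k l)%N.

(* All factorials in the denominator are invertible when i is less than the
   characteristic, the only case that is used. *)
Definition theta_coef (F : fieldType) (i : nat) (k : {ffun 'I_i -> 'I_i.+1}) :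
    F :=
  (-1) ^+ (theta_size k).-1 *
  (((theta_size k).-1)`!)%:R / (\prod_(l < i) (k l)`!)%:R.

Definition theta (F : fieldType) (A : comUnitAlgType F) (i : nat)
    (x : nat -> A) : A :=
  \sum_(k : {ffun 'I_i -> 'I_i.+1} | theta_index k)
     theta_coef F k *: \prod_(l < i) (x l.+1 / x 0%N) ^+ k l.

(* x_0^i theta_i(x) with denominators cleared, see thetabarE. *)
Definition thetabar (F : fieldType) (A : comAlgType F) (i : nat)
    (x : nat -> A) : A :=
  \sum_(k : {ffun 'I_i -> 'I_i.+1} | theta_index k)
     theta_coef F k *:
       (x 0%N ^+ (i - theta_size k) * \prod_(l < i) x l.+1 ^+ k l).

Lemma thetabarE (F : fieldType) (A : comUnitAlgType F) (i : nat)
    (x : nat -> A) :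
  x 0%N \is a GRing.unit -> thetabar i x = x 0%N ^+ i * theta i x.
Proof.
move=> x0U; rewrite /thetabar /theta mulr_sumr; apply: eq_bigr => k /eqP ik.
rewrite -scalerAr; congr (_ *: _).
have le_ki : (theta_size k <= i)%N.
  by rewrite -[X in (_ <= X)%N]ik; apply: leq_sum => l _; rewrite leq_pmull.
have -> : x 0%N ^+ i = x 0%N ^+ (i - theta_size k) * x 0%N ^+ theta_size k.
  by rewrite -exprD subnK.
rewrite -mulrA; congr (_ * _).
rewrite /theta_size -prodrXr -big_split /=; apply: eq_bigr => l _.
by rewrite -exprMn mulrCA mulrV // mulr1.
Qed.

Definition mu (A : comNzRingType) (a b : nat) (y : nat -> A) : A :=
  if (b < a)%N then 0 else
  if (a == 0%N) && (b == 0%N) then 1 else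
  \sum_(j : {ffun 'I_a -> 'I_b.+1} |
          [forall l, (0 < j l)%N] && (\sum_(l < a) j l == b)%N)
     \prod_(l < a) y (j l).

(* c = (c_1, ..., c_(m-1)) is indexed from 0, whence the shift. *)
Definition shift (F : fieldType) (m : nat) (c : 'rV[F]_m) (l : nat) : F :=
  entry c l.-1.

Definition mu_mx (F : fieldType) (m : nat) (c : 'rV[F]_m.-1) : 'M[F]_m :=
  \matrix_(a < m, b < m) mu a b (shift c).

Definition mu_mx' (F : fieldType) (m : nat) (c : 'rV[F]_m.-1) :
    'M[F]_m.-1 :=
  \matrix_(a < m.-1, b < m.-1) mu a.+1 b.+1 (shift c).

(* Membership in W(m); for m = 1 there is no c_1, and W(1) = {1}. *)
Definition in_W (F : fieldType) (m : nat) (M : 'M[F]_m) : Prop :=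
  exists2 c : 'rV[F]_m.-1, (1 < m)%N -> shift c 1 != 0 & M = mu_mx c.

(* Delta = (n_0^(m_0), ..., n_(k-1)^(m_(k-1))), a partition of
   part_size n_ m_. *)

Definition part_size (k : nat) (n_ m_ : 'I_k -> nat) : nat :=
  (\sum_(i < k) \sum_(j < m_ i) n_ i)%N.

Definition zblock (F : fieldType) (k d : nat) (n_ m_ : 'I_k -> nat)
    (z : 'M[F]_(d, part_size n_ m_)) (i : 'I_k) (j : 'I_(m_ i)) :
    'M[F]_(d, n_ i) :=
  submxrow (q_ := fun=> n_ i)
    (submxrow (q_ := fun i => (\sum_(j < m_ i) n_ i)%N) z i) j.

Definition block_perm_mx (F : fieldType) (n m : nat) (s : 'S_m) :
    'M[F]_(\sum_(j < m) n) :=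
  \mxblock_(a < m, b < m) (if a == s b then 1%:M else 0 : 'M[F]_n).

Definition w_mx (F : fieldType) (k : nat) (n_ m_ : 'I_k -> nat)
    (c : forall i, 'I_(m_ i) -> 'rV[F]_(n_ i).-1)
    (sigma : forall i, 'S_(m_ i)) : 'M[F]_(part_size n_ m_) :=
  \mxdiag_(i < k) ((\mxdiag_(j < m_ i) mu_mx (c i j))
                   *m block_perm_mx F (n_ i) (sigma i)).

Section XDelta.

Variables (F : finFieldType) (k d : nat) (n_ m_ : 'I_k -> nat).

Definition t_idx : finType := {i : 'I_k & 'I_(m_ i)}.

(* (i, j, r) stands for u_(i, j, r+1). *)
Definition u_idx : finType := {i : 'I_k & ('I_(m_ i) * 'I_(n_ i).-1)%type}.

Definition X_coord : finType := (t_idx + u_idx + 'I_d)%type.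

Definition t_c i (j : 'I_(m_ i)) : X_coord :=
  inl (inl (existT (fun i => 'I_(m_ i)) i j)).
Definition u_c i (j : 'I_(m_ i)) (r : 'I_(n_ i).-1) : X_coord :=
  inl (inr (existT (fun i => ('I_(m_ i) * 'I_(n_ i).-1)%type) i (j, r))).
Definition s_c (l : 'I_d) : X_coord := inr l.

Let P := {mpoly F[#|X_coord|]}.
Let N := #|F|.-1.

Definition sz (z : 'M[F]_(d, part_size n_ m_)) (i : 'I_k) (j : 'I_(m_ i)) :
    'rV[P]_(n_ i) :=
  (\row_l var F (s_c l)) *m map_mx (@mpolyC _ F) (zblock z j).

Definition X_eqn (z : 'M[F]_(d, part_size n_ m_)) (e : t_idx + u_idx) : P :=
  match e with
  | inl (existT i j) => var F (t_c j) ^+ N - entry (sz z j) 0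
  | inr (existT i (j, r)) =>
      var F (t_c j) ^+ (N * r.+1) *
        (var F (u_c j r) ^+ #|F| - var F (u_c j r))
      - thetabar r.+1 (entry (sz z j))
  end.

Definition X_neq (e : t_idx) : P :=
  let: existT i j := e in var F (t_c j).

Definition X_ (z : 'M[F]_(d, part_size n_ m_)) : affineVar F :=
  AffineVar (X_eqn z) X_neq.

Definition f_w (c : forall i, 'I_(m_ i) -> 'rV[F]_(n_ i).-1)
    (sigma : forall i, 'S_(m_ i)) (z z' : 'M[F]_(d, part_size n_ m_)) :
    regmap (X_ z) (X_ z') :=
  let co (v : X_coord) : regfun (X_ z) :=
    var F (inl v : X_coord + t_idx)%type in
  fun v : X_coord =>
  match v with
  | inl (inl (existT i j)) => co (t_c (sigma i j))
  | inl (inr (existT i (j, r))) =>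
      ((\row_a co (u_c (sigma i j) a))
         *m map_mx (@mpolyC _ F) (mu_mx' (c i (sigma i j)))) 0 r
  | inr l => co (s_c l)
  end.

End XDelta.

Arguments f_w {F k d n_ m_} c sigma z z'.

(* Main.v *)
Require Import Defs.
From mathcomp Require Import all_boot all_order all_fingroup all_algebra.
From mathcomp Require Import mpoly finfield.
From mathcomp.algebra_tactics Require Import ring.

Set Implicit Arguments.
Unset Strict Implicit.
Unset Printing Implicit Defensive.

Import GRing.Theory.
Local Open Scope ring_scope.

(* Put x(T) = \sum_l x_l T^l and C(T) = \sum_(j > 0) c_j T^j. Then mu_(a,b)(c)
   is the coefficient of T^b in C(T)^a and theta_i(x) the coefficient of T^i in
   log (x(T) / x_0). Hence right multiplication of x by mu(c) is the
   substitution x(C(T)) mod T^m, and (theta_b)_(b > 0) is transformed linearly by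
   mu(c)'. The map v |-> v^q - v being F_q-linear, the row of the differences
   u_r^q - u_r - theta_r is transformed by mu(c)' as well; since mu(c)' is
   triangular with diagonal entries c_1^a, this row vanishes at u if and only if
   it vanishes at u mu(c)'. So points correspond to points in both directions,
   and the inverse of f_w is given by the matrices mu(c)'^-1. *)

(** * Coefficients of powers and the polynomials mu *)

Lemma eq_coef_exp (R : nzRingType) (P Q : {poly R}) (b s : nat) :
    (forall l, (l <= b)%N -> P`_l = Q`_l) ->
  forall l, (l <= b)%N -> (P ^+ s)`_l = (Q ^+ s)`_l.
Proof.
move=> ePQ; elim: s => [|s IHs] l le_lb; first by rewrite !expr0.
rewrite !exprS !coefM; apply: eq_bigr => j _.
by rewrite ePQ ?IHs // (leq_trans _ le_lb) // ?leq_subr // -ltnS.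
Qed.

Lemma coef_exp_small (R : nzRingType) (P : {poly R}) (i s : nat) :
  P`_0 = 0 -> (i < s)%N -> (P ^+ s)`_i = 0.
Proof.
move=> P0; elim: s i => [//|s IHs] i lt_is.
rewrite exprS coefM big1 // => -[[|j] lt_j] _ /=; first by rewrite P0 mul0r.
by rewrite IHs ?mulr0 //; case: i lt_is lt_j => // i; rewrite !ltnS subSS;
   move=> *; apply: leq_ltn_trans (leq_subr _ _) _.
Qed.

(** Expanding the power gives a sum over [a]-tuples of exponents with sum [b]; tuples with a zero
    part vanish since [C] has no constant term. Coefficients above [b] do not matter, so [C] may be
    any truncation of the series. *)
Lemma mu_coef (R : comNzRingType) (a b : nat) (y : nat -> R) (C : {poly R}) :
    C`_0 = 0 -> (forall j, (0 < j <= b)%N -> C`_j = y j) ->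
  mu a b y = (C ^+ a)`_b.
Proof.
move=> C0 Cy; rewrite /mu; case: ifPn => [lt_ba|_].
  by rewrite coef_exp_small.
case: ifPn => [/andP[/eqP-> /eqP->]|_]; first by rewrite expr0 coef1.
(* [D] is [C] cut off above degree [b], so that its power expands over the same functions that index
   [mu]. *)
pose D := \sum_(j < b.+1) (C`_j)%:P * 'X^j.
have eCD l : (l <= b)%N -> C`_l = D`_l.
  rewrite -ltnS => lt_lb; rewrite coef_sum (bigD1 (Ordinal lt_lb)) //=.
  rewrite coefCM coefXn eqxx mulr1 big1 ?addr0 // => j.
  by rewrite coefCM coefXn -val_eqE /= eq_sym => /negbTE->; rewrite mulr0.
rewrite (eq_coef_exp _ eCD) // /D.
rewrite -[a in _ ^+ a]card_ord -prodr_const bigA_distr_bigA coef_sum /=.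
rewrite [LHS]big_mkcond /=; apply: eq_bigr => j _.
rewrite big_split /= prodrXr -rmorph_prod coefCM coefXn eq_sym.
case: eqP => [sj|_]; last by rewrite andbF mulr0.
rewrite andbT mulr1; case: forallP => [jgt0|].
  by apply: eq_bigr => l _; rewrite Cy // jgt0 -ltnS ltn_ord.
move/forallP/forallPn => [l]; rewrite -eqn0Ngt => /eqP jl.
by rewrite (bigD1 l) //= jl C0 mul0r.
Qed.

(** * Truncated exponentials and the logarithm *)

Section Multinomial.

Variables (R : comNzRingType) (e : nat -> R) (B : nat).
Hypothesis eK : forall j, (j <= B)%N -> j`!%:R * e j = 1.

Let truncexp (a : R) : {poly R} := \poly_(j < B.+1) (e j * a ^+ j).

(** This is exp(aT) exp(bT) = exp((a+b)T) up to degree [B], iterated over the factors. *)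
Let coef_truncexp_prod (n : nat) (a : 'I_n -> R) (s : nat) :
  (s <= B)%N -> (\prod_l truncexp (a l))`_s = e s * (\sum_l a l) ^+ s.
Proof.
elim: n a s => [|n IHn] a s le_sB.
  rewrite !big_ord0 coef1 expr0n; case: s le_sB => [|s] _; last by rewrite mulr0.
  by rewrite mulr1 -[e 0]mul1r -[1 in RHS]/(0`!%:R) eK.
rewrite !big_ord_recl coefMr exprDn mulr_sumr; apply: eq_bigr => -[j lt_j] _ /=.
have le_js : (j <= s)%N by [].
have le_jB := leq_trans le_js le_sB.
rewrite IHn // coef_poly ltnS (leq_trans (leq_subr _ _)) //.
rewrite -[_ *+ _]mulr_natr.
suff E : e (s - j)%N * e j = e s * 'C(s, j)%:R.
  by rewrite mulrACA E [RHS]mulrA mulrAC.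
have le_sjB : (s - j <= B)%N by apply: leq_trans (leq_subr _ _) le_sB.
have es := eK le_sB; rewrite -(bin_fact le_js) !natrM in es.
(* Insert s! [e s] = 1 with s! = C(s,j) j! (s-j)!, then cancel j! and (s-j)! against [e j] and
   [e (s - j)]. *)
transitivity ('C(s, j)%:R * (j`!%:R * (s - j)`!%:R) * e s *
    (e (s - j)%N * e j)).
  by rewrite es mul1r.
transitivity (e s * 'C(s, j)%:R *
    (j`!%:R * e j) * ((s - j)`!%:R * e (s - j)%N)); first by ring.
by rewrite !eK // !mulr1.
Qed.

(* The multinomial theorem with e j = 1 / j!, read off from the coefficient of
   T^s in the product of the truncated exponentials of the a_l T. *)
Lemma sum_divided_powers (n : nat) (a : 'I_n -> R) (s : nat) : (s <= B)%N ->
  \sum_(k : {ffun 'I_n -> 'I_B.+1} | (\sum_l k l == s)%N)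
     \prod_l (e (k l) * a l ^+ k l) = e s * (\sum_l a l) ^+ s.
Proof.
move=> le_sB; rewrite -coef_truncexp_prod //.
under [in RHS]eq_bigr do rewrite /truncexp poly_def.
rewrite bigA_distr_bigA coef_sum /= [LHS]big_mkcond /=; apply: eq_bigr => k _.
under [in RHS]eq_bigr do rewrite -mul_polyC.
rewrite [in RHS]big_split /= prodrXr -rmorph_prod coefCM coefXn eq_sym.
by case: eqP => _; rewrite ?mulr1 ?mulr0.
Qed.

End Multinomial.

(* The coefficient (-1)^(s-1) / s of Q^s in log (1 + Q), in the shape in which
   it occurs in theta; the value 1 at s = 0 is junk. *)
Definition log_coef (F : fieldType) (s : nat) : F :=
  (-1) ^+ s.-1 * (s.-1)`!%:R / s`!%:R.

Lemma pchar_fact_neq0 (F : fieldType) (p j : nat) :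
  p \in [pchar F] -> (j < p)%N -> j`!%:R != 0 :> F.
Proof.
move=> hp lt_jp; have p_pr := pcharf_prime hp.
rewrite -(dvdn_pcharf hp).
elim: j lt_jp => [|j IHj] lt_jp; first by rewrite fact0 gtnNdvd ?prime_gt1.
by rewrite factS Euclid_dvdM // negb_or IHj 1?ltnW // gtnNdvd.
Qed.

(** Group the exponent tuples by their size s: the factor (-1)^(s-1) (s-1)! is constant on a group,
    and the remaining divided powers sum to the coefficient of Q^s / s! by the multinomial
    theorem. *)
Lemma theta_log (F : fieldType) (p : nat) (A : comUnitAlgType F) (i : nat)
    (x : nat -> A) (Q : {poly A}) :
    p \in [pchar F] -> (i < p)%N ->
    Q`_0 = 0 -> (forall l, (0 < l <= i)%N -> Q`_l = x l / x 0%N) ->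
  theta i x = \sum_(s < i.+1) log_coef F s *: (Q ^+ s)`_i.
Proof.
move=> hp lt_ip Q0 Qx.
(* The constants 1/j! are placed in [{poly A}] because the multinomial theorem is applied to the
   monomials of [Q]. *)
pose e j : {poly A} := (GRing.in_alg A (j`!%:R^-1))%:P.
have eK j : (j <= i)%N -> j`!%:R * e j = 1.
  move=> le_ji; rewrite /e -(rmorph_nat (polyC : {rmorphism A -> _})).
  rewrite -(rmorph_nat (GRing.in_alg A)) -!rmorphM /= divff ?scale1r //.
  by rewrite (pchar_fact_neq0 hp) // (leq_ltn_trans le_ji).
pose D := \sum_(l < i) (x l.+1 / x 0%N)%:P * 'X^(l.+1).
have eQD l : (l <= i)%N -> Q`_l = D`_l.
  rewrite coef_sum; case: l => [_|l lt_li].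
    by rewrite Q0 big1 // => l _; rewrite coefCM coefXn mulr0.
  rewrite Qx // (bigD1 (Ordinal lt_li)) //=.
  rewrite coefCM coefXn eqxx mulr1 big1 ?addr0 // => j.
  by rewrite coefCM coefXn eqSS -val_eqE /= eq_sym => /negbTE->; rewrite mulr0.
have le_ki (k : {ffun 'I_i -> 'I_i.+1}) :
    theta_index k -> (theta_size k < i.+1)%N.
  move=> /eqP ik; rewrite ltnS -[X in (_ <= X)%N]ik.
  by apply: leq_sum => l _; rewrite leq_pmull.
have coef_term (k : {ffun 'I_i -> 'I_i.+1}) :
    (\prod_(l < i) (e (k l) * ((x l.+1 / x 0%N)%:P * 'X^(l.+1)) ^+ k l))`_i =
    if theta_index k then ((\prod_(l < i) (k l)`!)%:R^-1 : F) *: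
      \prod_(l < i) (x l.+1 / x 0%N) ^+ k l else 0.
  under eq_bigr do rewrite exprMn -exprM -rmorphXn mulrA -rmorphM.
  rewrite big_split /= prodrXr -rmorph_prod coefCM coefXn eq_sym.
  rewrite -[(_ == _)]/(theta_index k); case: ifP => _; last by rewrite mulr0.
  rewrite mulr1 big_split /= -mulr_algl; congr (_ * _).
  by rewrite natr_prod -prodfV -(rmorph_prod (GRing.in_alg A)).
rewrite /theta.
(* Weight [i] bounds the size by [i], so [inord] does not alter it. *)
rewrite (partition_big (fun k => inord (theta_size k) : 'I_i.+1) xpredT) //=.
apply: eq_bigr => -[s lt_s] _ /=.
rewrite (eq_coef_exp _ eQD) // /log_coef -scalerA.
have -> : (s`!%:R^-1 : F) *: (D ^+ s)`_i = (e s * D ^+ s)`_i.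
  by rewrite coefCM mulr_algl.
rewrite -(sum_divided_powers eK) // coef_sum scaler_sumr.
rewrite [LHS]big_mkcond [RHS]big_mkcond /=; apply: eq_bigr => k _.
rewrite coef_term.
case: (boolP (theta_index k)) => [ik|/negbTE nik] /=; last first.
  by rewrite scaler0 if_same.
rewrite -val_eqE /= inordK ?le_ki //; case: eqP => // sk.
by rewrite scalerA /theta_coef sk.
Qed.

(** * Theta under substitution *)

Lemma theta_subst (F : fieldType) (p : nat) (A : comUnitAlgType F) (m : nat)
    (c : nat -> F) (x y : nat -> A) :
    p \in [pchar F] -> (m <= p)%N ->
    (forall b, (b < m)%N -> y b = \sum_(a < m) x a * (mu a b c)%:A) ->
  forall b, (0 < b < m)%N ->
    theta b y = \sum_(a < m | (0 < a)%N) theta a x * (mu a b c)%:A.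
Proof.
move=> hp le_mp yE b /andP[b_gt0 lt_bm].
pose C := \poly_(j < m) (if j == 0%N then 0 else c j).
have muC a l : (l < m)%N -> mu a l c = (C ^+ a)`_l.
  move=> lt_lm; apply: mu_coef => [|j /andP[j_gt0 le_jl]].
    by rewrite coef_poly eqxx if_same.
  by rewrite coef_poly (leq_ltn_trans le_jl) // eqn0Ngt j_gt0.
have m_gt0 : (0 < m)%N by apply: leq_ltn_trans lt_bm.
have mu00 : mu 0 0 c = 1 by rewrite /mu.
have C0 : C`_0 = 0 by rewrite coef_poly eqxx if_same.
have mua0 a : (0 < a)%N -> mu a 0 c = 0 by move=> a_gt0; rewrite /mu a_gt0.
have mu0b l : (0 < l < m)%N -> mu 0 l c = 0.
  by case/andP=> l_gt0 lt_lm; rewrite muC // expr0 coef1 eqn0Ngt l_gt0.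
have y0 : y 0%N = x 0%N.
  rewrite yE // (bigD1 (Ordinal m_gt0)) //= mu00 scale1r mulr1.
  rewrite big1 ?addr0 // => a.
  by rewrite -val_eqE /= -lt0n => a_gt0; rewrite mua0 // scale0r mulr0.
(* [Q] stands for x(T)/x_0 - 1 modulo T^m; since y_0 = x_0, composing it with C gives y(T)/y_0 - 1
   modulo T^m. *)
pose Q := \sum_(a < m | (0 < a)%N) (x a / x 0%N)%:P * 'X^a.
have Qx l : (0 < l < m)%N -> Q`_l = x l / x 0%N.
  case/andP=> l_gt0 lt_lm; rewrite coef_sum (bigD1 (Ordinal lt_lm)) //=.
  rewrite coefCM coefXn eqxx mulr1 big1 ?addr0 // => j /andP[_].
  by rewrite coefCM coefXn -val_eqE /= eq_sym => /negbTE->; rewrite mulr0.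
have Q0 : Q`_0 = 0.
  rewrite coef_sum big1 // => j; rewrite coefCM coefXn lt0n eq_sym.
  by move=> /negbTE->; rewrite mulr0.
pose CA := map_poly (GRing.in_alg A) C.
have coefCA a l : (l < m)%N -> (CA ^+ a)`_l = (mu a l c)%:A.
  by move=> lt_lm; rewrite -rmorphXn coef_map /= muC.
have coef_comp (P : {poly A}) l : (l < m)%N ->
    (P \Po CA)`_l = \sum_(a < m) P`_a * (mu a l c)%:A.
  move=> lt_lm; rewrite coef_comp_poly.
  (* Both sums are compared over the larger range: surplus terms vanish either beyond the size of
     [P], or because C^a has order at least a >= m > l. *)
  transitivity (\sum_(a < maxn (size P) m) P`_a * (CA ^+ a)`_l).
    rewrite (big_ord_widen _ (fun a => P`_a * (CA ^+ a)`_l) (leq_maxl _ m)).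
    rewrite [LHS]big_mkcond; apply: eq_bigr => a _; case: ltnP => // le_Pa.
    by rewrite nth_default ?mul0r.
  have CA_exp0 a : (m <= a)%N -> (CA ^+ a)`_l = 0.
    move=> le_ma; apply: coef_exp_small; last exact: leq_trans lt_lm le_ma.
    by rewrite coef_map C0 /= scale0r.
  rewrite [RHS](eq_bigr (fun a : 'I_m => P`_a * (CA ^+ a)`_l)); last first.
    by move=> a _; rewrite coefCA.
  rewrite (big_ord_widen _ (fun a => P`_a * (CA ^+ a)`_l) (leq_maxr (size P) m)).
  rewrite [RHS]big_mkcond; apply: eq_bigr => a _; case: ltnP => // le_ma.
  by rewrite CA_exp0 ?mulr0.
rewrite (@theta_log _ p _ b y (Q \Po CA)) ?(leq_trans lt_bm) //; first last.
- move=> l /andP[l_gt0 le_lb]; have lt_lm := leq_ltn_trans le_lb lt_bm.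
  rewrite coef_comp // y0 yE // mulr_suml; apply: eq_bigr => a _.
  case: (posnP a) => [->|a_gt0].
    by rewrite mu0b ?l_gt0 // scale0r !mulr0 mul0r.
  by rewrite Qx ?a_gt0 ?ltn_ord // mulrAC.
- rewrite coef_comp // big1 // => a _; case: (posnP a) => [->|a_gt0].
    by rewrite Q0 mul0r.
  by rewrite mua0 // scale0r mulr0.
(* Powers commute with composition, so each Q^s contributes its coefficients times mu_(a,b);
   exchanging the sums collects theta_a. *)
under eq_bigr => s _ do rewrite -rmorphXn /= coef_comp // scaler_sumr.
rewrite exchange_big /= [RHS]big_mkcond /=; apply: eq_bigr => a _.
case: ltnP => [a_gt0|]; last first.
  rewrite leqn0 => /eqP->; rewrite big1 // => s _.
  by rewrite mu0b ?b_gt0 // scale0r mulr0 scaler0.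
case: (ltnP b a) => [lt_ba|le_ab].
  rewrite {2}/mu lt_ba scale0r mulr0 big1 // => s _.
  by rewrite /mu lt_ba scale0r mulr0 scaler0.
rewrite (@theta_log _ p _ a x Q) ?(leq_trans (ltn_ord a)) //; last first.
  move=> l /andP[l_gt0 le_la].
  by rewrite Qx // l_gt0 (leq_ltn_trans le_la).
(* The sum for theta_a stops at s = a, the other one at s = b; the terms in between vanish since Q^s
   has order at least s > a. *)
rewrite mulr_suml (big_ord_widen b.+1
  (fun s => log_coef F s *: (Q ^+ s)`_a * (mu a b c)%:A)) //.
rewrite [RHS]big_mkcond /=; apply: eq_bigr => s _; rewrite scalerAl.
by case: ltnP => // lt_as; rewrite coef_exp_small // scaler0 mul0r.
Qed.

(** * Invertibility of mu(c)' *)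

Lemma mu_diag (R : comNzRingType) (a : nat) (y : nat -> R) :
  mu a a y = y 1%N ^+ a.
Proof.
pose C := \poly_(j < a.+1) (if j == 0%N then 0 else y j).
have C0 : C`_0 = 0 by rewrite coef_poly.
rewrite (@mu_coef _ _ _ _ C) // => [|j /andP[j_gt0 le_ja]]; last first.
  by rewrite coef_poly ltnS le_ja eqn0Ngt j_gt0.
have C1 : (0 < a)%N -> C`_1 = y 1%N.
  by move=> a_gt0; rewrite coef_poly ltnS a_gt0.
have coefC b : (C ^+ b)`_b = C`_1 ^+ b.
  elim: b => [|b IHb]; first by rewrite !expr0 coef1.
  rewrite !exprS coefM !big_ord_recl /= C0 mul0r add0r subSS subn0 IHb.
  rewrite big1 ?addr0 // => -[j lt_jb] _ /=; rewrite /bump /= !add1n subSS.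
  by rewrite (@coef_exp_small _ C) ?mulr0 //; case: b lt_jb {IHb} => // b _;
     rewrite subSS ltnS leq_subr.
by rewrite coefC; case: (posnP a) => [->|/C1->].
Qed.

(** [in_W] only provides some parameter [c'] with the same matrix; comparing the entries (1,1)
    transfers the condition to [c]. *)
Lemma in_W_shift_neq0 (F : fieldType) (m : nat) (c : 'rV[F]_m.-1) :
  in_W (mu_mx c) -> (1 < m)%N -> shift c 1 != 0.
Proof.
case=> c' c'1 eq_mu m_gt1; pose o := Ordinal m_gt1.
have := congr1 (fun M : 'M_m => M o o) eq_mu.
by rewrite !mxE /= !mu_diag !expr1 => ->; apply: c'1.
Qed.

Lemma mu_mx'_unit (F : fieldType) (m : nat) (c : 'rV[F]_m.-1) :
  ((1 < m)%N -> shift c 1 != 0) -> mu_mx' c \in unitmx.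
Proof.
move=> c1; rewrite unitmxE -det_tr det_trig; last first.
  by apply/is_trig_mxP => a b lt_ab; rewrite !mxE /mu ltnS lt_ab.
rewrite unitfE; apply/prodf_neq0 => a _; rewrite !mxE mu_diag expf_neq0 // c1 //.
(* An index in ['I_m.-1] exists only when [1 < m]. *)
by case: m a {c c1} => [|[|m]] [].
Qed.

(** * The equations of a single block *)

Lemma entry_ord (A : nmodType) (m : nat) (v : 'rV[A]_m) (r : 'I_m) :
  entry v r = v 0 r.
Proof. by rewrite /entry valK. Qed.

(** The conditions at one pair (i,j), with [x] in the role of s z^(i,j). *)
Definition block_eqs (F : finFieldType) (A : comUnitAlgType F) (n : nat)
    (t : A) (u : 'rV[A]_n.-1) (x : 'rV[A]_n) : Prop :=
  [/\ t \is a GRing.unit, t ^+ #|F|.-1 = entry x 0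
    & forall r : 'I_n.-1,
        t ^+ (#|F|.-1 * r.+1) * (u 0 r ^+ #|F| - u 0 r)
          = thetabar r.+1 (entry x)].

Lemma sum_pos_ord (V : nmodType) (n : nat) (G : nat -> V) :
  \sum_(a < n | (0 < a)%N) G a = \sum_(a < n.-1) G a.+1.
Proof.
case: n => [|n]; first by rewrite !big_ord0.
by rewrite big_mkcond big_ord_recl /= add0r.
Qed.

Section BlockEquations.

Variables (F : finFieldType) (p : nat) (A : comUnitAlgType F) (n : nat).
Hypotheses (hp : p \in [pchar F]) (n_gt0 : (0 < n)%N) (le_np : (n <= p)%N).

(** The q-th power is additive in characteristic p and fixes the entries of [M], which lie in
    [F]. *)
Lemma expr_card_linear (m l : nat) (u : 'rV[A]_m) (M : 'M[F]_(m, l)) (r : 'I_l) :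
  (u *m map_mx (GRing.in_alg A) M) 0 r ^+ #|F| =
  \sum_a u 0 a ^+ #|F| * (M a r)%:A.
Proof.
have cardF_pnat : [pchar A].-nat #|F|.
  have cardF : #|F| = (p ^ logn p #|F|)%N := card_pprimeChar hp.
  rewrite cardF pnatX pnatE ?(pcharf_prime hp) //.
  by apply/orP; left; rewrite pchar_lalg.
rewrite mxE; elim/big_ind2: _ => [|a a' b b' <- <-|a _].
- by rewrite expr0n gtn_eqF // (cardD1 0).
- by rewrite exprDn_pchar.
by rewrite !mxE exprMn -(rmorphXn (GRing.in_alg A)) /= expf_card.
Qed.

(** The Artin-Schreier equations after division by t^(Nr) = x_0^r, which turns [thetabar] into
    [theta]; in this form mu(c)' acts on them linearly. *)
Let asdefect (u : 'rV[A]_n.-1) (x : 'rV[A]_n) : 'rV[A]_n.-1 :=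
  \row_r (u 0 r ^+ #|F| - u 0 r - theta r.+1 (entry x)).

Lemma block_eqsE (t : A) (u : 'rV[A]_n.-1) (x : 'rV[A]_n) :
  block_eqs t u x <->
  [/\ t \is a GRing.unit, t ^+ #|F|.-1 = entry x 0 & asdefect u x = 0].
Proof.
split=> -[tU tx E]; split=> //.
  have xU : entry x 0 \is a GRing.unit by rewrite -tx unitrX.
  apply/rowP => r; rewrite !mxE; apply: (mulrI (unitrX r.+1 xU)).
  by rewrite mulr0 mulrBr -thetabarE // -{1}tx -exprM E subrr.
have xU : entry x 0 \is a GRing.unit by rewrite -tx unitrX.
move=> r; rewrite thetabarE // -tx -exprM; congr (_ * _).
by apply/subr0_eq; move/rowP/(_ r): E; rewrite !mxE.
Qed.

Variable c : 'rV[F]_n.-1.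
Hypothesis c1 : (1 < n)%N -> shift c 1 != 0.

Let muA := map_mx (GRing.in_alg A) (mu_mx c).
Let muA' := map_mx (GRing.in_alg A) (mu_mx' c).

Lemma entry_mul_mu (x : 'rV[A]_n) (b : nat) : (b < n)%N ->
  entry (x *m muA) b = \sum_(a < n) entry x a * (mu a b (shift c))%:A.
Proof.
move=> lt_bn; rewrite -[b in LHS]/(val (Ordinal lt_bn)) entry_ord mxE.
by apply: eq_bigr => a _; rewrite !mxE entry_ord.
Qed.

Lemma entry0_mul_mu (x : 'rV[A]_n) : entry (x *m muA) 0 = entry x 0.
Proof.
rewrite entry_mul_mu // (bigD1 (Ordinal n_gt0)) //= big1 ?addr0.
  by rewrite /mu /= scale1r mulr1.
by move=> a; rewrite -val_eqE /= -lt0n /mu => ->; rewrite scale0r mulr0.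
Qed.

Let asdefect_mul_mu (u : 'rV[A]_n.-1) (x : 'rV[A]_n) :
  asdefect (u *m muA') (x *m muA) = asdefect u x *m muA'.
Proof.
apply/rowP => r; rewrite [LHS]mxE expr_card_linear.
rewrite (theta_subst hp le_np (entry_mul_mu x)); last first.
  by rewrite /= -ltn_predRL.
rewrite (sum_pos_ord _ (fun a => theta a (entry x) * (mu a r.+1 (shift c))%:A)).
rewrite !mxE -!sumrB; apply: eq_bigr => a _.
by rewrite !mxE /= !mulrBl.
Qed.

(** An equivalence, so that it serves both f_w and its inverse: x_0 is unchanged, and the defect is
    multiplied by an invertible matrix. *)
Lemma block_eqs_mul_mu (t : A) (u : 'rV[A]_n.-1) (x : 'rV[A]_n) :
  block_eqs t (u *m muA') (x *m muA) <-> block_eqs t u x.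
Proof.
rewrite !block_eqsE entry0_mul_mu asdefect_mul_mu.
split=> -[tU tx E]; split=> //; last by rewrite E mul0mx.
rewrite -[LHS]mulmx1 -(map_mx1 (GRing.in_alg A)) -(mulmxV (mu_mx'_unit c1)).
by rewrite map_mxM mulmxA E mul0mx.
Qed.

End BlockEquations.

(** * Evaluation of polynomials at points *)

Section Evaluation.

Variables (F : fieldType) (I : finType) (A : comUnitAlgType F) (x : I -> A).

Lemma peval_var (i : I) : peval x (var F i) = x i.
Proof. by rewrite /peval /var mmapX mmap1U enum_rankK. Qed.

Lemma peval_mulC (m l : nat) (v : 'rV[{mpoly F[#|I|]}]_m) (M : 'M[F]_(m, l)) :
  map_mx (peval x) (v *m map_mx (@mpolyC _ F) M) =
  map_mx (peval x) v *m map_mx (GRing.in_alg A) M.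
Proof.
apply/rowP => r; rewrite !mxE /peval rmorph_sum; apply: eq_bigr => a _.
by rewrite !mxE rmorphM /= mmapC.
Qed.

Lemma peval_mulC_entry (m l : nat) (v : 'rV[{mpoly F[#|I|]}]_m)
    (M : 'M[F]_(m, l)) (r : 'I_l) :
  peval x ((v *m map_mx (@mpolyC _ F) M) 0 r) =
  (map_mx (peval x) v *m map_mx (GRing.in_alg A) M) 0 r.
Proof. by rewrite -peval_mulC [RHS]mxE. Qed.

Lemma peval_entry (m : nat) (v : 'rV[{mpoly F[#|I|]}]_m) (r : nat) :
  peval x (entry v r) = entry (map_mx (peval x) v) r.
Proof.
by rewrite /entry; case: insub => [o|]; rewrite ?mxE // /peval rmorph0.
Qed.

Lemma peval_thetabar (i : nat) (v : nat -> {mpoly F[#|I|]}) :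
  peval x (thetabar i v) = thetabar i (fun l => peval x (v l)).
Proof.
rewrite /thetabar /peval rmorph_sum; apply: eq_bigr => k _.
rewrite /= mmapZ mulr_algl rmorphM rmorphXn rmorph_prod /=.
by under eq_bigr do rewrite rmorphXn.
Qed.

End Evaluation.

Lemma eq_thetabar (F : fieldType) (A : comAlgType F) (i : nat) (x y : nat -> A) :
  x =1 y -> thetabar i x = thetabar i y.
Proof.
move=> exy; rewrite /thetabar; apply: eq_bigr => k _; rewrite exy.
by under eq_bigr do rewrite exy.
Qed.

(** * Blocks of zw and points of the varieties *)

Lemma zblock_mul_w (F : fieldType) (k d : nat) (n_ m_ : 'I_k -> nat)
    (z : 'M[F]_(d, part_size n_ m_))
    (c : forall i, 'I_(m_ i) -> 'rV[F]_(n_ i).-1)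
    (sigma : forall i, 'S_(m_ i)) (i : 'I_k) (j : 'I_(m_ i)) :
  zblock (z *m w_mx c sigma) j =
  zblock z (sigma i j) *m mu_mx (c i (sigma i j)).
Proof.
rewrite /zblock /w_mx -{1}[z]submxrowK mul_mxrow_mxdiag mxrowK mulmxA.
set Z := submxrow z i; rewrite -{1}[Z]submxrowK mul_mxrow_mxdiag.
rewrite mul_mxrow_mxblock mxrowK (bigD1 (sigma i j)) //= eqxx mulmx1.
by rewrite big1 ?addr0 // => a /negbTE->; rewrite mulmx0.
Qed.

Section Points.

Variables (F : finFieldType) (k d : nat) (n_ m_ : 'I_k -> nat).

Definition s_row (A : Type) (x : X_coord d n_ m_ -> A) : 'rV[A]_d :=
  \row_l x (s_c n_ m_ l).

Definition u_row (A : Type) (x : X_coord d n_ m_ -> A) (i : 'I_k)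
    (j : 'I_(m_ i)) : 'rV[A]_(n_ i).-1 :=
  \row_r x (u_c d j r).

(** The pairs (i,j) are coupled only through s, so points can be treated block by block. *)
Lemma X_pointP (z : 'M[F]_(d, part_size n_ m_)) (A : comUnitAlgType F)
    (x : X_coord d n_ m_ -> A) :
  is_point (V := X_ z) x <->
  forall (i : 'I_k) (j : 'I_(m_ i)),
    block_eqs (x (t_c d n_ j)) (u_row x j)
      (s_row x *m map_mx (GRing.in_alg A) (zblock z j)).
Proof.
have sE : map_mx (peval x) (\row_l var F (s_c n_ m_ l)) = s_row x.
  by apply/rowP => l; rewrite !mxE peval_var.
have tE i (j : 'I_(m_ i)) : peval x (X_eqn z (inl (existT _ i j))) =
    x (t_c d n_ j) ^+ #|F|.-1
    - entry (s_row x *m map_mx (GRing.in_alg A) (zblock z j)) 0.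
  rewrite /= -sE -peval_mulC -peval_entry -(peval_var x (t_c d n_ j)).
  by rewrite /peval rmorphB rmorphXn.
have uE i (j : 'I_(m_ i)) r : peval x (X_eqn z (inr (existT _ i (j, r)))) =
    x (t_c d n_ j) ^+ (#|F|.-1 * r.+1) *
      (u_row x j 0 r ^+ #|F| - u_row x j 0 r)
    - thetabar r.+1
        (entry (s_row x *m map_mx (GRing.in_alg A) (zblock z j))).
  rewrite /= -sE -peval_mulC -(eq_thetabar _ (peval_entry x _)) -peval_thetabar.
  rewrite mxE -(peval_var x (t_c d n_ j)) -(peval_var x (u_c d j r)).
  by rewrite /peval rmorphB rmorphM rmorphB !rmorphXn.
split=> [[eq0 neq0] i j|blocks]; last split.
- split=> [||r].
  + by rewrite -(peval_var x); apply: (neq0 (existT _ i j)).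
  + by apply/subr0_eq; rewrite -tE; exact: (eq0 (inl (existT _ i j))).
  + by apply/subr0_eq; rewrite -uE; exact: (eq0 (inr (existT _ i (j, r)))).
- case=> [[i j]|[i [j r]]]; have [_ tx ux] := blocks i j.
  + by rewrite tE tx subrr.
  + by rewrite uE ux subrr.
case=> i j; have [tU _ _] := blocks i j.
by rewrite /= peval_var.
Qed.

(** The common shape of f_w and its inverse, so that their action on points is computed only
    once. *)
Definition block_map (tau : forall i, 'S_(m_ i))
    (M : forall i, 'I_(m_ i) -> 'M[F]_((n_ i).-1))
    (z z' : 'M[F]_(d, part_size n_ m_)) : regmap (X_ z) (X_ z') :=
  let co (v : X_coord d n_ m_) : regfun (X_ z) :=
    var F (inl v : X_coord d n_ m_ + t_idx m_)%type in
  fun v : X_coord d n_ m_ =>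
  match v with
  | inl (inl (existT i j)) => co (t_c d n_ (tau i j))
  | inl (inr (existT i (j, r))) =>
      ((\row_a co (u_c d (tau i j) a)) *m map_mx (@mpolyC _ F) (M i j)) 0 r
  | inr l => co (s_c n_ m_ l)
  end.

Arguments block_map : clear implicits.

Section BlockMapPoints.

Variables (tau : forall i, 'S_(m_ i)).
Variables (M : forall i, 'I_(m_ i) -> 'M[F]_((n_ i).-1)).
Variables (z z' : 'M[F]_(d, part_size n_ m_)) (A : comUnitAlgType F).
Variable x : X_coord d n_ m_ -> A.

Let y : X_coord d n_ m_ -> A :=
  rmap (block_map tau M z z') x.

Lemma rmap_t i (j : 'I_(m_ i)) : y (t_c d n_ j) = x (t_c d n_ (tau i j)).
Proof. by rewrite /y /rmap /reval peval_var. Qed.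

Lemma rmap_s : s_row y = s_row x.
Proof. by apply/rowP => l; rewrite !mxE /y /rmap /reval peval_var. Qed.

Lemma rmap_u i (j : 'I_(m_ i)) :
  u_row y j = u_row x (tau i j) *m map_mx (GRing.in_alg A) (M j).
Proof.
apply/rowP => r; rewrite mxE /y /rmap /reval /block_map /=.
rewrite peval_mulC_entry; congr ((_ *m _) 0 r).
by apply/rowP => a; rewrite !mxE peval_var.
Qed.

End BlockMapPoints.

Lemma coord_ext (A : Type) (x y : X_coord d n_ m_ -> A) :
    (forall i (j : 'I_(m_ i)), x (t_c d n_ j) = y (t_c d n_ j)) ->
    (forall i (j : 'I_(m_ i)), u_row x j = u_row y j) ->
    s_row x = s_row y ->
  x =1 y.
Proof.
move=> et eu es [[[i j]|[i [j r]]]|l].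
- exact: et.
- by move/rowP/(_ r): (eu i j); rewrite !mxE.
- by move/rowP/(_ l): es; rewrite !mxE.
Qed.

End Points.

Arguments block_map {F k d n_ m_} tau M z z'.

Theorem theorem5p2 (F : finFieldType) (p : nat) (hp : p \in [pchar F])
    (k d : nat) (n_ m_ : 'I_k -> nat)
    (n_gt0 : forall i, (0 < n_ i)%N) (m_gt0 : forall i, (0 < m_ i)%N)
    (n_incr : forall i j : 'I_k, (i < j)%N -> (n_ i < n_ j)%N)
    (n_le_p : forall i, (n_ i <= p)%N)
    (z : 'M[F]_(d, part_size n_ m_))
    (c : forall i, 'I_(m_ i) -> 'rV[F]_(n_ i).-1)
    (sigma : forall i, 'S_(m_ i))
    (hw : forall (i : 'I_k) (j : 'I_(m_ i)), in_W (mu_mx (c i j))) :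
  is_isomorphism (f_w c sigma z (z *m w_mx c sigma)).
Proof.
have c1 i j := in_W_shift_neq0 (hw i j).
pose w := w_mx c sigma.
pose f := block_map sigma (fun i j => mu_mx' (c i (sigma i j))) z (z *m w).
(* At index j the map f applies mu' of c_(sigma(j)); hence the inverse takes index sigma^-1(j) and
   undoes mu' of c_j. *)
pose g := block_map (fun i => (sigma i)^-1%g)
  (fun i j => invmx (mu_mx' (c i j))) (z *m w) z.
(* [f_w] and this [block_map] agree by conversion. *)
rewrite -[f_w _ _ _ _]/f.
have muK (A : comUnitAlgType F) i j :
    map_mx (GRing.in_alg A) (mu_mx' (c i j)) *m
    map_mx (GRing.in_alg A) (invmx (mu_mx' (c i j))) = 1%:M.
  by rewrite -map_mxM mulmxV ?map_mx1 //; apply/mu_mx'_unit/c1.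
have muKV (A : comUnitAlgType F) i j :
    map_mx (GRing.in_alg A) (invmx (mu_mx' (c i j))) *m
    map_mx (GRing.in_alg A) (mu_mx' (c i j)) = 1%:M.
  by rewrite -map_mxM mulVmx ?map_mx1 //; apply/mu_mx'_unit/c1.
split; last exists g; first 1 last.
- split=> A x.
  + move=> /X_pointP xP; apply/X_pointP => i j.
    rewrite rmap_t rmap_u rmap_s.
    (* After multiplication by mu and mu' the goal is the hypothesis at sigma^-1(j), as that block
       of zw is block j of z times mu(c_j). *)
    apply/(block_eqs_mul_mu hp (n_gt0 i) (n_le_p i) (c1 i j)).
    rewrite -mulmxA muKV mulmx1 -mulmxA -map_mxM.
    by have := xP i ((sigma i)^-1%g j); rewrite zblock_mul_w permKV.
  + move=> _; apply: coord_ext => [i j|i j|].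
    * by rewrite !rmap_t permKV.
    * by rewrite !rmap_u permKV -mulmxA muK mulmx1.
    * by rewrite !rmap_s.
  + move=> _; apply: coord_ext => [i j|i j|].
    * by rewrite !rmap_t permK.
    * by rewrite !rmap_u permK -mulmxA muKV mulmx1.
    * by rewrite !rmap_s.
move=> A x /X_pointP xP; apply/X_pointP => i j.
rewrite rmap_t rmap_u rmap_s zblock_mul_w map_mxM mulmxA.
exact/(block_eqs_mul_mu hp (n_gt0 i) (n_le_p i) (c1 i (sigma i j))).
Qed.
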